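(* Let $\Gamma$ be a word hyperbolic group and let $\mu$ be a non-elementary probability measure on $\Gamma$. For every $\rho\in[0,1)$ we have $$\liminf_{n\to\infty}\|\pi^\rho_n-\mu_n\times\mu_n\|_{\mathrm{TV}}>0.$$
   Context: A probability measure $\mu$ on a word hyperbolic group $\Gamma$ is called non-elementary if its support generates, as a group, a non-elementary subgroup $\mathrm{gr}(\mu)$ of $\Gamma$ (equivalently, $\mathrm{gr}(\mu)$ contains a free group of rank greater than one). For $\rho\in[0,1]$, the probability measure $\pi^\rho$ on $\Gamma\times\Gamma$ is $\pi^\rho:=\rho\,\mu\times\mu+(1-\rho)\mu_{\mathrm{diag}}$, where $\mu\times\mu$ is the product measure and $\mu_{\mathrm{diag}}((x,y))=\mu(x)$ if $x=y$ and $0$ otherwise. For a probability measure on a group, the subscript $n$ denotes the $n$-fold convolution power: $\mu_n$ is the law of $w_n=x_1\cdots x_n$, with $x_1,x_2,\dots$ independent with law $\mu$, and $\pi^\rho_n$ is the $n$-fold convolution of $\pi^\rho$ on the direct product group $\Gamma\times\Gamma$. For probability measures $\nu_1,\nu_2$ on a countable set $X$, $\|\nu_1-\nu_2\|_{\mathrm{TV}}:=\sup_{A\subset X}|\nu_1(A)-\nu_2(A)|$. *)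

(* Defs.v *)
From HB Require Import structures.
From mathcomp Require Import all_boot all_order all_algebra.
From mathcomp Require Import all_classical all_reals all_analysis.

Set Implicit Arguments.
Unset Strict Implicit.
Unset Printing Implicit Defensive.

Import Order.TTheory GRing.Theory Num.Theory.
Import numFieldNormedType.Exports.

Local Open Scope classical_set_scope.
Local Open Scope group_scope.
Local Open Scope ring_scope.

Section groups.
Variable G : groupType.
Implicit Types (S : seq G) (H A T : set G) (x y z w : G).

Definition is_subgroup H := group_closed [in H].

Definition subgroup_generated A : set G := smallest is_subgroup A.

(* a cyclic subgroup of H has finitely many cosets in H; finite subgroups are
   covered by g = 1 *)
Definition virtually_cyclic H := exists2 g, H g &
  exists2 T, finite_set T &
    H `<=` [set (c * t)%g | c in subgroup_generated [set g] & t in T].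

Definition non_elementary_subgroup H := is_subgroup H /\ ~ virtually_cyclic H.

(* words in the letters S and their inverses *)
Definition group_word S (u : seq G) :=
  all (fun s => (s \in S) || (s^-1%g \in S)) u.

Definition generating S :=
  forall x, exists2 u, group_word S u & x = (\prod_(s <- u) s)%g.

Section hyperbolicity.
Variable R : realType.

(* graph distance in the Cayley graph: edges join x and x * s *)
Definition word_dist S x y : R := inf
  [set (size u)%:R | u in [set u | group_word S u /\
                                   y = (x * \prod_(s <- u) s)%g]].

Definition gromov_product S w x y : R :=
  (word_dist S x w + word_dist S y w - word_dist S x y) / 2.

(* Gromov's four-point condition for the word metric of some finite generating
   family *)
Definition word_hyperbolic := exists2 S, generating S &
  exists delta : R, forall w x y z,
    Num.min (gromov_product S w x y) (gromov_product S w y z) - delta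
      <= gromov_product S w x z.

End hyperbolicity.
End groups.

(* [discr G] is the group G with every subset measurable; when G is countable,
   [probability (discr G) R] amounts to probability mass functions on G *)
Definition discr (G : Type) : Type := G.

Section discr_instances.
Variable G : groupType.

HB.instance Definition _ := Group.on (discr G).
HB.instance Definition _ := isPointed.Build (discr G) (1%g : G).
HB.instance Definition _ := @isMeasurable.Build default_measure_display
  (discr G) discrete_measurable discrete_measurable0
  discrete_measurableC discrete_measurableU.

End discr_instances.

Section discr_maps.
Variables (G : groupType) (d : measure_display) (T : measurableType d).
Variable f : discr G -> T.

Lemma measurable_fun_discr : measurable_fun [set: discr G] f.
Proof. by move=> _ B _. Qed.

Definition discr_mfun : {mfun discr G >-> T} :=
  HB.pack f (@isMeasurableFun.Build _ _ (discr G) T f measurable_fun_discr).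

End discr_maps.

Section product_law.
Local Open Scope ereal_scope.
Variables (R : realType) (G H : groupType).
Variables (mu : probability (discr G) R) (nu : probability (discr H) R).

(* the library's product measure is only known to be a measure for the product
   sigma-algebra, which may be smaller than that of [discr (G * H)] *)
Definition product_law : set (discr (G * H)%type) -> \bar R := mu \x nu.

Let product_law0 : product_law set0 = 0.
Proof. by rewrite /product_law measure0. Qed.

Let product_law_ge0 A : 0 <= product_law A.
Proof. exact: integral_ge0. Qed.

Let product_law_sigma_additive : semi_sigma_additive product_law.
Proof.
move=> F mF tF mUF.
rewrite [X in _ --> X](_ : _ = \sum_(n <oo) product_law (F n)).
  by apply/cvg_closeP; split; [exact: is_cvg_nneseries|rewrite closeE].
rewrite -integral_nneseries//.
apply: eq_integral => x _; apply/esym/cvg_lim => //=; rewrite xsection_bigcup.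
apply: (@measure_sigma_additive _ _ _ nu (fun n => xsection (F n) x)).
  by [].
exact: trivIset_xsection.
Qed.

HB.instance Definition _ := isMeasure.Build _ _ _ product_law
  product_law0 product_law_ge0 product_law_sigma_additive.

Let product_law_setT : product_law setT = 1.
Proof.
rewrite -[setT]setXTT.
rewrite [LHS](@product_measure1E _ _ (discr G) (discr H) R mu nu)//.
by apply: etrans (mule1 1); congr (_ * _); exact: probability_setT.
Qed.

HB.instance Definition _ :=
  Measure_isProbability.Build _ _ _ product_law product_law_setT.

End product_law.

Section mixture.
Local Open Scope ereal_scope.
Variables (d : measure_display) (T : measurableType d) (R : realType).
Variables (p : {i01 R}) (m1 m2 : probability T R).

Definition mixture : set T -> \bar R :=
  measure_add (mscale p%:num%:nng%R m1) (mscale (1 - p%:num)%:nng%R m2).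

HB.instance Definition _ := Measure.on mixture.

Lemma mixtureE A :
  mixture A = p%:num%:E * m1 A + (1 - p%:num)%:E * m2 A.
Proof. by rewrite /mixture measure_addE. Qed.

Let mixture_setT : mixture setT = 1.
Proof.
by rewrite mixtureE !probability_setT !mule1 -EFinD addrC subrK.
Qed.

HB.instance Definition _ :=
  Measure_isProbability.Build _ _ _ mixture mixture_setT.

End mixture.

Section convolution.
Variables (R : realType) (G : groupType).
Implicit Types mu nu : probability (discr G) R.

Definition convolution mu nu : probability (discr G) R :=
  distribution (product_law mu nu)
    (discr_mfun (fun xy : discr (G * G)%type => (xy.1 * xy.2)%g : discr G)).

Fixpoint convolution_power mu n : probability (discr G) R :=
  if n is n'.+1 then convolution (convolution_power mu n') mu
  else \d_(1%g : discr G).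

Definition diagonal_law mu : probability (discr (G * G)%type) R :=
  distribution mu (discr_mfun (fun x : discr G => (x, x) : discr (G * G)%type)).

Definition noisy_law mu (rho : {i01 R}) : probability (discr (G * G)%type) R :=
  mixture rho (product_law mu mu) (diagonal_law mu).

Definition law_support mu : set G := [set x | mu [set x] != 0%E].

Definition non_elementary mu :=
  non_elementary_subgroup (subgroup_generated (law_support mu)).

Definition tv_dist mu nu : \bar R :=
  ereal_sup [set `|mu A - nu A|%E | A in [set: set (discr G)]].

Lemma diagonal_law1 mu (x y : G) :
  diagonal_law mu [set (x, y)] = if x == y then mu [set x] else 0%E.
Proof.
rewrite /diagonal_law /distribution /= /pushforward.
case: eqP => [<-|xy].
  by congr (mu _); apply/seteqP; split => z /= [] // ->.
rewrite -[RHS](measure0 mu); congr (mu _).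
by apply/seteqP; split => z //= [-> /xy].
Qed.

End convolution.

(* Main.v *)
Require Import Defs.
From mathcomp Require Import all_boot all_order all_algebra finmap.
From mathcomp Require Import all_classical all_reals all_analysis.
From mathcomp Require Import lra zify.

(** Suppose that the total variation distance comes arbitrarily close to zero at
    arbitrarily large times. The proof turns this into a finitely additive
    probability on [G] that is invariant under the subgroup generated by the
    support of [mu], and shows that only virtually cyclic subgroups of a hyperbolic
    group have one.

    From closeness to invariance. Let [h] be a bounded [mu]-harmonic function
    and [F (x, y) = h x * h y]. Under the noisy law, a step of the pair is
    either an independent one, which preserves [F] on average, or, with
    probability [1 - rho], a common one, which adds the covariance of the two
    increments of [h]. Since [h] is a bounded martingale along each walk, its
    increments, hence these covariances, tend to zero in mean: the averages of [F]
    at times [n] and [n + 1] are close to each other. Where the law of the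
    pair is close to the product law, the average of [F] from a starting point
    [z] at time [n] is close to [F z]. Comparing the two gives that [F] is
    harmonic at [1] for the pair, so the covariance at [(1, 1)], which is the
    variance of [h] after one step, vanishes: [h] is constant along the support
    ([harmonic_support]). If [L] is a limit of Cesaro averages of the laws of the
    walk along an ultrafilter, then [g |-> L 1_(g^-1 A)] is harmonic for every set
    [A], and its invariance is the invariance of [L] ([invariant_mean_of_tv]).

    From invariance to virtual cyclicity. Let [m] be a mean invariant under an
    infinite subgroup [H]. When [g] in [H] is long, every point of [G] is either
    far in the direction of [g] as seen from [1], or far in the direction of [1]
    as seen from [g]; by invariance, some shadow at distance [t] has mass at
    least one half, for every [t] ([big_shadow]). Since two out of three sets of
    such mass meet, one obtains a boundary point all of whose shadows have mass at
    least one half ([coherent_shadows]) and whose stabilizer in [H] has index at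
    most two. On the stabilizer, the Busemann function at this point is a
    quasimorphism ([busemannM]) taking small values finitely often
    ([busemann_finite]), so the stabilizer is virtually cyclic
    ([quasimorphism_virtually_cyclic]). The boundary itself is never formed: a
    boundary point is a sequence with large mutual Gromov products. *)

Set Implicit Arguments.
Unset Strict Implicit.
Unset Printing Implicit Defensive.

Import Order.TTheory GRing.Theory Num.Theory.
Import numFieldNormedType.Exports.

Local Open Scope classical_set_scope.
Local Open Scope ring_scope.

(** * Filters *)

Lemma near_all_seq (I : Type) (F : set_system I) (T : eqType) (s : seq T)
    (P : T -> I -> Prop) : Filter F ->
  (forall a, a \in s -> \forall k \near F, P a k) ->
  \forall k \near F, forall a, a \in s -> P a k.
Proof.
move=> FF; elim: s => [|a s IHs] Ps; first by near=> k.
have Psa : forall b, b \in s -> \forall k \near F, P b k.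
  by move=> b bs; apply: Ps; rewrite inE bs orbT.
apply: filterS2 (Ps a (mem_head a s)) (IHs Psa) => k Pak Pk b.
by rewrite inE => /orP[/eqP->//|]; exact: Pk.
Unshelve. all: by end_near. Qed.

Lemma fmap_ultra (T T' : Type) (f : T -> T') (F : set_system T) :
  UltraFilter F -> UltraFilter (f @ F).
Proof.
move=> FU; split; first exact: fmap_proper_filter.
move=> K PK FK; apply/seteqP; split => A; last exact: FK.
move=> KA; have [//|FnA] := in_ultra_setVsetC (f @^-1` A) FU.
have KnA : K (~` A) by exact: FK.
by have [x []] := filter_ex (filterI KA KnA).
Qed.

(** * Subgroups *)

Section subgroups.
Variables (G : groupType) (H : set G).
Hypothesis sgH : is_subgroup H.

Lemma subgroup1 : H 1%g. Proof. by have [/set_mem] := sgH. Qed.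

Lemma subgroup_div x y : H x -> H y -> H (x / y)%g.
Proof.
by move=> Hx Hy; have [_ /(_ x y)] := sgH; rewrite !inE; apply.
Qed.

Lemma subgroupV x : H x -> H x^-1%g.
Proof. by move=> Hx; rewrite -div1g; exact: subgroup_div subgroup1 Hx. Qed.

Lemma subgroupM x y : H x -> H y -> H (x * y)%g.
Proof. by move=> Hx /subgroupV Hy; rewrite -[y]invgK; exact: subgroup_div. Qed.

End subgroups.

Lemma is_subgroupP (G : groupType) (H : set G) : H 1%g ->
  (forall x y, H x -> H y -> H (x / y)%g) -> is_subgroup H.
Proof.
move=> H1 Hdiv; split; first by rewrite inE.
by move=> x y; rewrite !inE; exact: Hdiv.
Qed.

Lemma subgroup_generatedP (G : groupType) (A : set G) :
  is_subgroup (subgroup_generated A).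
Proof.
apply: is_subgroupP => [K [/subgroup1]//|x y Ax Ay K AK].
by apply: (subgroup_div AK.1); [exact: Ax|exact: Ay].
Qed.

Section virtually_cyclic.
Variables (G : groupType) (H : set G).
Hypothesis sgH : is_subgroup H.

Lemma finite_virtually_cyclic : finite_set H -> virtually_cyclic H.
Proof.
move=> Hfin; exists 1%g; first exact: subgroup1.
exists H => // h Hh; exists 1%g; last by exists h => //; rewrite mul1g.
exact: subgroup1 (subgroup_generatedP _).
Qed.

Lemma index2_virtually_cyclic (K : set G) a :
  is_subgroup K -> K `<=` H -> (forall h, H h -> K h \/ K (a^-1 * h)%g) ->
  virtually_cyclic K -> virtually_cyclic H.
Proof.
move=> sgK KH HK [g Kg [T Tfin KT]]; exists g; first exact: KH.
exists (T `|` [set (t * a^-1)%g | t in T]).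
  by rewrite finite_setU; split=> //; exact: finite_image.
move=> h Hh; case: (HK _ (subgroupV sgH Hh)) => /(subgroupV sgK).
  by rewrite invgK => /KT[c gc [t Tt <-]]; exists c => //; exists t => //; left.
rewrite invgM !invgK => /KT[c gc [t Tt cth]]; exists c => //.
exists (t * a^-1)%g; first by right; exists t.
by rewrite mulgA cth mulgK.
Qed.

(** A proper quasimorphism to the line behaves like a quasi-isometry. If it is
    bounded the group is finite; otherwise take [g] with a value larger than all
    errors. Multiplying by powers of [g] brings any element into the finite set
    where [beta] is at most [beta g + 3 * D] in absolute value. *)
Lemma quasimorphism_virtually_cyclic (R : realType) (beta : G -> R) (D : R) :
  (forall g h, H g -> H h -> `|beta (g * h)%g - beta g - beta h| <= D) ->
  (forall r, finite_set [set g | H g /\ `|beta g| <= r]) ->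
  virtually_cyclic H.
Proof.
move=> quasi fin.
(* the margin [5 * D + 1] leaves [3 * D + 1] after replacing [g] with its inverse *)
have [|bounded] := pselect (exists2 g, H g & 5 * D + 1 <= `|beta g|); last first.
  apply: finite_virtually_cyclic; apply: sub_finite_set (fin (5 * D + 1)).
  move=> g Hg; split=> //; rewrite leNgt; apply/negP => /ltW Dg.
  by apply: bounded; exists g.
have H1 := subgroup1 sgH.
have betaV g : H g ->
    - beta g - 2 * D <= beta g^-1%g <= - beta g + 2 * D.
  move=> Hg; have := quasi _ _ H1 H1; have := quasi _ _ Hg (subgroupV sgH Hg).
  by rewrite mulgV mul1g !ler_norml => /andP[? ?] /andP[? ?]; apply/andP; split; lra.
have D0 : 0 <= D by exact: le_trans (quasi _ _ H1 H1).
move=> [g0 Hg0 Dg0]; have [g Hg Dg] : exists2 g, H g & 3 * D + 1 <= beta g.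
  move: Dg0; rewrite ler_normr => /orP[|] Dg; first by exists g0 => //; lra.
  exists g0^-1%g; first exact: subgroupV.
  by have /andP[] := betaV _ Hg0; lra.
exists g => //; exists [set h | H h /\ `|beta h| <= beta g + 3 * D] => // h.
have sgg := subgroup_generatedP [set g].
have gg : subgroup_generated [set g] g by move=> K [_]; exact.
have [n] : exists n : nat, `|beta h| <= n%:R.
  by exists (Num.truncn `|beta h|).+1; exact/ltW/truncnS_gt.
(* each multiplication by [g] or its inverse lowers the absolute value by at
   least one *)
elim: n h => [|n IHn] h hn Hh.
all: have [hr|hr] := leP `|beta h| (beta g + 3 * D).
1,3: by exists 1%g; [exact: (subgroup1 sgg)|exists h => //; rewrite mul1g].
  by lra.
have [h0|h0] := leP 0 (beta h).
  have /andP[b1 b2] := betaV _ Hg; have Hgh := subgroupM sgH (subgroupV sgH Hg) Hh.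
  have : `|beta (g^-1 * h)%g| <= n%:R.
    have := quasi _ _ (subgroupV sgH Hg) Hh; move: hn hr; rewrite (ger0_norm h0).
    by rewrite mulrS !ler_norml => ? ? /andP[? ?]; apply/andP; split; lra.
  move=> /IHn -/(_ Hgh)[c gc [t Tt cth]]; exists (g * c)%g; first exact: (subgroupM sgg).
  by exists t => //; rewrite -mulgA cth mulVKg.
have Hgh := subgroupM sgH Hg Hh.
have : `|beta (g * h)%g| <= n%:R.
  have := quasi _ _ Hg Hh; move: hn hr; rewrite (ltr0_norm h0).
  by rewrite mulrS !ler_norml => ? ? /andP[? ?]; apply/andP; split; lra.
move=> /IHn -/(_ Hgh)[c gc [t Tt cth]]; exists (g^-1 * c)%g.
  by apply: (subgroupM sgg) => //; exact: (subgroupV sgg).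
by exists t => //; rewrite -mulgA cth mulKg.
Qed.

End virtually_cyclic.

(** * Finitely additive invariant means *)

Section means.
Variables (R : realType) (G : groupType).
Implicit Types (m : set G -> R) (A B C H : set G).

Definition finitely_additive m := [/\ m setT = 1, forall A, 0 <= m A &
  forall A B, A `&` B = set0 -> m (A `|` B) = m A + m B].

Definition left_invariant H m :=
  forall h A, H h -> m [set x | A (h * x)%g] = m A.

Variable m : set G -> R.
Hypothesis fam : finitely_additive m.

Lemma mean_le A B : A `<=` B -> m A <= m B.
Proof.
move=> AB; case: fam => _ m0 mU; rewrite -(setDUK AB) mU ?setDIK//.
by rewrite lerDl.
Qed.

Lemma mean_cover A B : (forall x, A x \/ B x) -> 2^-1 <= m A \/ 2^-1 <= m B.
Proof.
move=> AB; apply/orP; rewrite -implyNb -ltNge; apply/implyP => mA.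
have [mT m0 mU] := fam.
have := mU A (~` A); rewrite setICr setUCr mT => /(_ erefl) m1.
have : m (~` A) <= m B by apply: mean_le => x nAx; case: (AB x).
by lra.
Qed.

(** Total mass [1] has no room for three disjoint sets of mass [1/2]. This is the
    finitary form of: at most two boundary points can carry an atom of mass at
    least one half. *)
Lemma mean_three A B C : 2^-1 <= m A -> 2^-1 <= m B -> 2^-1 <= m C ->
  [\/ A `&` B !=set0, A `&` C !=set0 | B `&` C !=set0].
Proof.
move=> mA mB mC; have [mT m0 mU] := fam.
have [|/set0P/negP/negPn/eqP AB] := pselect (A `&` B !=set0); first by constructor 1.
have [|/set0P/negP/negPn/eqP AC] := pselect (A `&` C !=set0); first by constructor 2.
have [|/set0P/negP/negPn/eqP BC] := pselect (B `&` C !=set0); first by constructor 3.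
have := mean_le (@subsetT _ ((A `|` B) `|` C)).
by rewrite mT !mU ?setIUl ?AC ?BC ?setU0// => ?; lra.
Qed.

End means.

(** * Word norms *)

Section word_norm.
Variables (G : groupType) (S : seq G).
Hypothesis genS : generating S.
Implicit Types x y : G.

Let has_word x n := `[< exists2 u, group_word S u &
  x = (\prod_(s <- u) s)%g /\ size u = n >].

Lemma word_norm_subproof x : exists n, has_word x n.
Proof.
by have [u Su xu] := genS x; exists (size u); apply/asboolP; exists u.
Qed.

Definition word_norm x := ex_minn (word_norm_subproof x).

Lemma word_normP x : exists2 u, group_word S u &
  x = (\prod_(s <- u) s)%g /\ size u = word_norm x.
Proof. by rewrite /word_norm; case: ex_minnP => n /asboolP. Qed.

Lemma word_norm_le u : group_word S u ->
  (word_norm (\prod_(s <- u) s)%g <= size u)%N.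
Proof.
move=> Su; rewrite /word_norm; case: ex_minnP => n _; apply.
by apply/asboolP; exists u.
Qed.

Lemma word_norm1 : word_norm 1%g = 0%N.
Proof.
by apply/eqP; rewrite -leqn0 -(big_nil 1%g *%g predT id) (@word_norm_le [::]).
Qed.

Lemma group_wordV u : group_word S u -> group_word S [seq s^-1%g | s <- rev u].
Proof.
rewrite /group_word all_map all_rev; apply: sub_all => s /=.
by rewrite orbC invgK.
Qed.

Lemma word_normV x : word_norm x^-1%g = word_norm x.
Proof.
suff le y : (word_norm y^-1%g <= word_norm y)%N.
  by apply/eqP; rewrite eqn_leq le -{1}[x]invgK le.
have [u /group_wordV Su [yu <-]] := word_normP y.
rewrite -(size_rev u) -(size_map (fun s => s^-1%g)).
suff -> : (y^-1 = \prod_(s <- [seq s^-1 | s <- rev u]) s)%g.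
  exact: word_norm_le.
by rewrite big_map prodgV revK yu.
Qed.

Lemma word_normM x y : (word_norm (x * y)%g <= word_norm x + word_norm y)%N.
Proof.
have [u Su [xu <-]] := word_normP x; have [v Sv [yv <-]] := word_normP y.
rewrite xu yv -big_cat -size_cat word_norm_le// /group_word all_cat.
exact/andP.
Qed.

(** Geodesics: a prefix of a shortest word is itself shortest, so the point at
    distance [n] from [1] on a geodesic from [1] to [x] is the product of the first
    [n] letters. *)
Lemma word_norm_split n x : (n <= word_norm x)%N ->
  exists2 p, word_norm p = n & word_norm (p^-1 * x)%g = (word_norm x - n)%N.
Proof.
have [u Su [xu szu]] := word_normP x; move=> nx.
move: (Su); rewrite -{1}(cat_take_drop n u) /group_word all_cat => /andP[S1 S2].
pose p := (\prod_(s <- take n u) s)%g.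
have xE : (p^-1 * x = \prod_(s <- drop n u) s)%g.
  by rewrite xu -{1}(cat_take_drop n u) big_cat/= mulKg.
have := word_norm_le S1; rewrite size_takel ?szu// -/p => pn.
have := word_norm_le S2; rewrite size_drop szu -xE => qn.
have := word_normM p (p^-1 * x)%g; rewrite mulVKg => xn.
by exists p; apply/eqP; rewrite eqn_leq; lia.
Qed.

(** Every finiteness statement below on sets of group elements comes from this local
    finiteness of the Cayley graph. *)
Lemma finite_word_ball n : finite_set [set x | (word_norm x <= n)%N].
Proof.
pose L := [set` S ++ [seq s^-1%g | s <- S]].
elim: n => [|n IHn].
  apply: (sub_finite_set _ (finite_set1 (1%g : G))) => x /=; rewrite leqn0 => /eqP x0.
  have [u _ [xu /eqP]] := word_normP x.
  by rewrite x0 size_eq0 xu => /eqP ->; rewrite big_nil.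
have finL : finite_set L by exact: finite_seq.
apply: (@sub_finite_set _ _ ([set 1%g] `|`
    [set (s * y)%g | s in L & y in [set y | (word_norm y <= n)%N]])); last first.
  rewrite finite_setU; split; first exact: finite_set1.
  exact: finite_image2.
move=> x /= xn; have [[|s v] Su [xu szu]] := word_normP x.
  by left; rewrite xu big_nil.
right; move: Su => /= /andP[Ss Sv]; exists s.
  rewrite /L /= mem_cat; case/orP: Ss => [->//|sS]; apply/orP; right.
  by apply/mapP; exists s^-1%g => //; rewrite invgK.
exists (\prod_(s <- v) s)%g; last by rewrite xu big_cons.
by have := word_norm_le Sv; move: szu xn => /=; lia.
Qed.

Lemma word_distE (R : realType) x y :
  word_dist R S x y = (word_norm (x^-1 * y)%g)%:R.
Proof.
have [u Su [xyu szu]] := word_normP (x^-1 * y)%g.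
have yE : y = (x * \prod_(s <- u) s)%g by rewrite -xyu mulVKg.
rewrite -szu; apply/eqP; rewrite eq_le; apply/andP; split.
  by apply: ge_inf; [exists 0 => _ [v _ <-]; rewrite ler0n|exists u].
apply: lb_le_inf; first by exists (size u)%:R; exists u.
move=> _ [v [Sv yv] <-]; rewrite ler_nat szu yv mulKg.
exact: word_norm_le.
Qed.

End word_norm.

(** * Gromov products, shadows and Busemann functions *)

Section hyperbolic.
Variables (R : realType) (G : groupType) (S : seq G) (genS : generating S).
Implicit Types (g h p x y z : G) (r t : R).

Let len x : R := (word_norm genS x)%:R.

Definition gprod x y : R := (len x + len y - len (x^-1 * y)%g) / 2.

Variable delta : R.
Hypothesis hyp : forall x y z,
  Num.min (gprod x y) (gprod y z) - delta <= gprod x z.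

Let len_ge0 x : 0 <= len x. Proof. exact: ler0n. Qed.
Let len1 : len 1%g = 0. Proof. by rewrite /len word_norm1. Qed.
Let lenV x : len x^-1%g = len x. Proof. by rewrite /len word_normV. Qed.
Let lenM x y : len (x * y)%g <= len x + len y.
Proof. by rewrite /len -natrD ler_nat word_normM. Qed.
Let lenVC x y : len (x^-1 * y)%g = len (y^-1 * x)%g.
Proof. by rewrite -lenV invgM invgK. Qed.

Lemma gprodC x y : gprod x y = gprod y x.
Proof. by rewrite /gprod lenVC [len x + _]addrC. Qed.

Lemma gprodxx x : gprod x x = len x.
Proof. by rewrite /gprod mulVg len1; lra. Qed.

Lemma gprod_le x y : gprod x y <= len x.
Proof.
by have := lenM x (x^-1 * y)%g; rewrite mulVKg /gprod; lra.
Qed.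

Lemma gprodM g x y : gprod x y - len g <= gprod (g * x)%g (g * y)%g.
Proof.
have := lenM g^-1%g (g * x)%g; have := lenM g^-1%g (g * y)%g.
by rewrite !mulKg /gprod invgM -mulgA mulKg lenV; lra.
Qed.

(** On a segment from [1] to [h], the projections of [y] seen from the two ends are
    at distances adding up to the length; [gprod h^-1 (h^-1 * y)] is the Gromov
    product of [1] and [y] based at [h]. *)
Lemma gprod_ends h y : gprod h y + gprod h^-1%g (h^-1 * y)%g = len h.
Proof. by rewrite /gprod invgK mulVKg lenV; lra. Qed.

Lemma delta_ge0 : 0 <= delta.
Proof. by have := hyp 1%g 1%g 1%g; rewrite minxx; lra. Qed.

Lemma gprod_trans t x y z : t <= gprod x y -> t <= gprod y z ->
  t - delta <= gprod x z.
Proof.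
move=> xy yz; apply: le_trans (hyp x y z).
by rewrite lerD2r le_min xy yz.
Qed.

(** The shadow of a point far away from [1], with [t] large, is a neighbourhood of a
    boundary point. *)
Definition shadow x t := [set y | t <= gprod x y].

Section invariant_mean.
Variables (H : set G) (m : set G -> R).
Hypotheses (sgH : is_subgroup H) (fam : finitely_additive m).
Hypothesis minv : left_invariant H m.

(** The mean concentrates near the boundary at every scale. If [h] in [H] has length
    at least [2 t], then [gprod_ends] shows that [G] is covered by the shadow of
    [h] and by the translate by [h] of the shadow of [h^-1]; one of them has
    mass at least one half, and the translation does not change the mass. *)
Lemma big_shadow t : infinite_set H -> exists x, 2^-1 <= m (shadow x t).
Proof.
move=> Hoo; have [n tn] : exists n : nat, 2 * t <= n%:R.
  by exists (Num.truncn (2 * t)).+1; apply/ltW/truncnS_gt.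
have [h Hh nh] : exists2 h, H h & (n <= word_norm genS h)%N.
  apply: contra_notP Hoo => nex; apply: sub_finite_set (finite_word_ball genS n).
  move=> h Hh /=; rewrite leqNgt; apply/negP => nh; apply: nex.
  by exists h => //; exact: ltnW.
have {}nh : n%:R <= len h by rewrite ler_nat.
have [||] := @mean_cover _ _ _ fam (shadow h t)
    [set y | shadow h^-1%g t (h^-1 * y)%g].
- move=> y; have := gprod_ends h y; rewrite /shadow /=.
  by have [|?] := leP t (gprod h y); [left|right; lra].
- by exists h.
- by rewrite minv; [exists h^-1%g|exact: subgroupV].
Qed.

(** The shadows of mass one half found at the various scales may hover around two
    different boundary points. Among any three of them two meet, so, along an
    ultrafilter on the scales, almost every shadow meets almost every other one,
    and those that do converge to a single boundary point. *)
Lemma coherent_shadows : infinite_set H -> exists x : nat -> G,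
  (forall n, 2^-1 <= m (shadow (x n) n%:R)) /\
  (forall n k, (n <= k)%N -> n%:R - 2 * delta <= gprod (x n) (x k)).
Proof.
move=> Hoo; have /choice[y my] : forall n : nat, exists x, 2^-1 <= m (shadow x n%:R).
  by move=> n; exact: big_shadow.
pose s n := shadow (y n) n%:R.
have [U [UU sU]] := @ultraFilterLemma nat \oo _.
pose T := [set n | U [set k | s n `&` s k !=set0]].
(* otherwise three pairwise disjoint shadows could be chosen one after another *)
have UT : U T.
  have [//|UnT] := in_ultra_setVsetC T UU.
  have [n1 n1T] := filter_ex UnT.
  have [//|U1] := in_ultra_setVsetC [set k | s n1 `&` s k !=set0] UU.
  have [n2 [n2T n12]] := filter_ex (filterI UnT U1).
  have [//|U2] := in_ultra_setVsetC [set k | s n2 `&` s k !=set0] UU.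
  have [n3 [n13 n23]] := filter_ex (filterI U1 U2).
  by have [/n12|/n13|/n23] := mean_three fam (my n1) (my n2) (my n3).
have Uge n : U [set k | (n <= k)%N] by apply: sU; exact: nbhs_infty_ge.
have /choice[f Tf] : forall n, exists k, T k /\ (n <= k)%N.
  by move=> n; have [k [Tk nk]] := filter_ex (filterI UT (Uge n)); exists k.
exists (y \o f); split => [n|n k nk].
  apply: le_trans (my (f n)) _; apply: mean_le => // z; rewrite /shadow/=.
  by apply: le_trans; rewrite ler_nat; case: (Tf n).
have [[Tn nf] [Tk kf]] := (Tf n, Tf k).
(* a third scale [j], whose shadow meets both, links the scales [f n] and [f k] *)
have [j [nj [[u [un uj]] [v [vk vj]]]]] := filter_ex (filterI (Uge n) (filterI Tn Tk)).
have lesh i z : (n <= i)%N -> s i z -> n%:R <= gprod (y i) z.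
  by move=> ni; apply: le_trans; rewrite ler_nat.
have nfk := leq_trans nk kf.
have nj1 : n%:R - delta <= gprod (y (f n)) (y j).
  by apply: (gprod_trans (y := u)); [exact: lesh|rewrite gprodC; exact: lesh].
have jk1 : n%:R - delta <= gprod (y j) (y (f k)).
  by apply: (gprod_trans (y := v)); [exact: lesh|rewrite gprodC; exact: lesh].
by have := gprod_trans nj1 jk1; rewrite /=; lra.
Qed.

End invariant_mean.

(** A bounded portion of the geodesics from [1] towards [z] and [z'] is common to
    both as soon as they fellow-travel for longer than [len g], so [g] cannot
    distinguish [z] from [z'] beyond [delta]. *)
Lemma gprod_close g z z' : len g <= gprod z z' ->
  `|gprod g z - gprod g z'| <= delta.
Proof.
suff le u v : len g <= gprod u v -> gprod g u - delta <= gprod g v.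
  move=> zz; have := le _ _ zz; move: zz; rewrite gprodC => /le.
  by rewrite ler_norml => ? ?; apply/andP; split; lra.
move=> uv; apply: (gprod_trans (y := u)) => //.
exact: le_trans (gprod_le _ _) uv.
Qed.

Lemma gprod_shift g z : len g - 2 * gprod g z = len (g^-1 * z)%g - len z.
Proof. by rewrite /gprod; lra. Qed.

Section boundary_point.
Variable x : nat -> G.
Hypothesis coh : forall n k, (n <= k)%N ->
  n%:R - 2 * delta <= gprod (x n) (x k).

(** The sequence [x] stands for the boundary point it converges to. Writing the
    stabilizer in this form, without any constant, makes it a subgroup at once. *)
Definition fixes_end g : Prop :=
  forall r, \forall k \near \oo, r <= gprod (g * x k)%g (x k).

Lemma near_natr_ge r : \forall k \near \oo, r <= k%:R.
Proof. exact: nbhs_infty_ger. Qed.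

Lemma fixes_end1 : fixes_end 1%g.
Proof.
move=> r; apply: filterS (near_natr_ge (r + 2 * delta)) => k rk.
by rewrite mul1g; have := coh (leqnn k); lra.
Qed.

Lemma fixes_endV g : fixes_end g -> fixes_end g^-1%g.
Proof.
move=> fg r; apply: filterS (fg (r + len g)) => k.
by have := gprodM g^-1%g (x k) (g * x k)%g; rewrite mulKg lenV gprodC; lra.
Qed.

Lemma fixes_endM g h : fixes_end g -> fixes_end h -> fixes_end (g * h)%g.
Proof.
move=> fg fh r.
apply: filterS2 (fg (r + delta)) (fh (r + delta + len g)) => k gk hk.
rewrite -[r](addrK delta); apply: gprod_trans gk.
by have := gprodM g (h * x k)%g (x k); rewrite mulgA; lra.
Qed.

Lemma fixes_end_subgroup : is_subgroup fixes_end.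
Proof.
apply: is_subgroupP fixes_end1 _ => g h fg /fixes_endV; exact: fixes_endM.
Qed.

(** If the shadows [shadow (x k) k] and their translates by [g] meet at arbitrarily
    large scales, then the limits of [x] and of its translate coincide. *)
Lemma fixes_end_meet g :
  (forall n, exists2 k, (n <= k)%N & exists2 v, shadow (x k) k%:R v &
    shadow (x k) k%:R (g * v)%g) -> fixes_end g.
Proof.
move=> meet r; have [n _ /(_ n (leqnn _)) rn] := near_natr_ge (r + len g + 5 * delta).
have [k nk [v vk gvk]] := meet n.
exists k => // j /= kj; have d0 := delta_ge0; have lg := len_ge0 g.
have nkR : n%:R <= k%:R :> R by rewrite ler_nat.
rewrite /shadow /= in vk gvk.
have xkj := coh kj.
have := gprodM g (x j) (x k); rewrite (gprodC (x j)) => e1.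
have := gprodM g (x k) v => e2.
have t1 : k%:R - len g - 2 * delta - delta <= gprod (g * x j)%g (g * v)%g.
  by apply: (gprod_trans (y := (g * x k)%g)); lra.
have t2 : k%:R - len g - 2 * delta - delta <= gprod (g * v)%g (x j).
  by apply: (gprod_trans (y := x k)); [rewrite gprodC|]; lra.
by have := gprod_trans t1 t2; lra.
Qed.

(** The Busemann function [len (g^-1 * z) - len z] for [z] tending to the boundary
    point, up to [2 * delta]: the term of [x] used here is far enough for the value
    to have settled. *)
Definition busemann g : R :=
  len g - 2 * gprod g (x (word_norm genS g + (Num.truncn (2 * delta)).+1)).

Lemma busemann_near g : \forall k \near \oo,
  `|busemann g - (len (g^-1 * x k)%g - len (x k))| <= 2 * delta.
Proof.
rewrite /busemann; set K := (word_norm _ _ + _)%N; exists K => // k /= Kk.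
rewrite -gprod_shift.
have /gprod_close : len g <= gprod (x K) (x k).
  have := coh Kk; rewrite {1}/K natrD -/(len g).
  by have := truncnS_gt (2 * delta); lra.
by rewrite !ler_norml; lra.
Qed.

(** On the stabilizer of the boundary point the Busemann function is a
    quasimorphism: it satisfies an exact cocycle identity at [x k], and [g^-1 * x k]
    may be replaced with [x k] since both converge to the same point. *)
Lemma busemannM g h : fixes_end g ->
  `|busemann (g * h)%g - busemann g - busemann h| <= 8 * delta.
Proof.
move=> /fixes_endV fg.
have [k [[ghk gk] [hk fgk]]] := filter_ex (filterI
  (filterI (busemann_near (g * h)%g) (busemann_near g))
  (filterI (busemann_near h) (fg (len h)))).
have := gprod_close fgk; move: ghk gk hk.
rewrite -(gprod_shift h) invgM -mulgA => ghk gk hk hgk.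
have := gprod_shift h (g^-1 * x k)%g; move: ghk gk hk hgk.
by rewrite !ler_norml; lra.
Qed.

(** Elements that fix the boundary point and shift by a bounded amount along the
    geodesic to it are boundedly many. Given finitely many of them, choose [p] on a
    geodesic from [1] to [x k], beyond the lengths of all of them and with [k] much
    larger still: each of them moves [p] by a bounded amount only, and by left
    invariance there are at most as many of them as points in a ball. This excludes
    parabolic behaviour and infinite torsion subgroups at once. *)
Lemma busemann_finite r :
  finite_set [set g | fixes_end g /\ `|busemann g| <= r].
Proof.
set A := (X in finite_set X); apply: contrapT => Aoo.
pose N := (Num.truncn (3 * r + 20 * delta)).+1.
have /finite_fsetP[B BE] := finite_word_ball genS N.
have [F FA FB] := infinite_set_fset (#|` B|).+1 Aoo.
pose tau := \max_(g <- F) word_norm genS g.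
have tauP g : g \in F -> len g <= tau%:R.
  by move=> gF; rewrite ler_nat; apply: leq_bigmax_seq.
have near_F : \forall k \near \oo, forall g, g \in F ->
    `|busemann g - (len (g^-1 * x k)%g - len (x k))| <= 2 * delta /\
    tau%:R <= gprod (g^-1 * x k)%g (x k).
  apply: near_all_seq => g gF; have [fg _] := FA _ gF.
  exact: filterI (busemann_near g) (fixes_endV fg _).
have [k [kF kt]] := filter_ex
  (filterI near_F (near_natr_ge (tau%:R + 2 * delta))).
have taux : (tau <= word_norm genS (x k))%N.
  by rewrite -(ler_nat R); have := coh (leqnn k); rewrite gprodxx; lra.
have [p pt pz] := word_norm_split taux.
have lp : len p = tau%:R by rewrite /len pt.
have lpz : len (p^-1 * x k)%g = len (x k) - tau%:R by rewrite /len pz natrB.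
pose f g := (p^-1 * (g^-1 * p))%g.
have finj : injective f by move=> g h /mulgI/mulIg/invg_inj.
have fB : ([fset f g | g in F] `<=` B)%fset.
  apply/fsubsetP => _ /imfsetP[g /= gF ->].
  have : [set` B] (f g); last by [].
  rewrite -BE /= -(ler_nat R) -/(len _).
  have [bg tg] := kF _ gF; have [_ rg] := FA _ gF; have lg := tauP _ gF.
  have gpz : gprod p (x k) = tau%:R by rewrite /gprod lp lpz; lra.
  have := @gprod_close g p (x k); rewrite gpz => /(_ lg) gp.
  have := gprod_shift g p; have := gprod_shift g (x k) => sk sp.
  pose q := (g^-1 * p)%g; rewrite -/q in sp *.
  have qk : gprod (g^-1 * x k)%g q =
      (len (g^-1 * x k)%g + len q - (len (x k) - tau%:R)) / 2.
    by rewrite /gprod /q invgM invgK -mulgA mulVKg (lenVC (x k) p) lpz.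
  have Nr := truncnS_gt (3 * r + 20 * delta).
  have d0 := delta_ge0.
  move: bg rg gp; rewrite !ler_norml => /andP[bg1 bg2] /andP[rg1 rg2] /andP[gp1 gp2].
  (* [q] is [p] shifted by at most [r + 4 * delta] along the geodesic to [x k],
     hence this lower bound for Gromov products with [g^-1 * x k] *)
  pose t := tau%:R - r - 4 * delta.
  have t1 : t - delta <= gprod p (g^-1 * x k)%g.
    by apply: (gprod_trans (y := x k)); rewrite 1?[gprod (x k) _]gprodC /t; lra.
  have t2 : t - delta <= gprod (g^-1 * x k)%g q by rewrite qk /t; lra.
  have := gprod_trans t1 t2; rewrite /gprod /t; rewrite -/N in Nr; lra.
have := fsubset_leq_card fB; rewrite (card_imfset imfset_key (mem F) finj).
by rewrite leqNgt FB.
Qed.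

End boundary_point.

End hyperbolic.

(** Every subgroup of a hyperbolic group that leaves a mean invariant is virtually
    cyclic. If the subgroup [H] is infinite, the mean singles out a boundary point,
    all of whose shadows have mass at least one half. At most one other translate of
    this point by [H] can exist, by [mean_three], so its stabilizer has index at most
    two in [H]; and the stabilizer is virtually cyclic because of its Busemann
    quasimorphism. *)
Lemma invariant_mean_virtually_cyclic (R : realType) (G : groupType)
    (H : set G) (m : set G -> R) :
  word_hyperbolic G R -> is_subgroup H -> finitely_additive m ->
  left_invariant H m -> virtually_cyclic H.
Proof.
move=> [S genS [delta hyp0]] sgH fam minv.
have hyp x y z : Num.min (gprod R genS x y) (gprod R genS y z) - delta
    <= gprod R genS x z.
  suff gpE u v : gprod R genS u v = gromov_product R S 1%g u v.
    by rewrite !gpE; exact: hyp0.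
  by rewrite /gromov_product !(word_distE genS) !mulg1 !word_normV.
have [|Hoo] := pselect (finite_set H); first exact: finite_virtually_cyclic.
have [x [mx coh]] := coherent_shadows hyp sgH fam minv Hoo.
pose K := [set g | H g /\ fixes_end R genS x g].
have sgF := fixes_end_subgroup hyp coh.
have sgK : is_subgroup K.
  apply: is_subgroupP; first by split; [exact: subgroup1|exact: (subgroup1 sgF)].
  by move=> g h [Hg fg] [Hh fh]; split; [exact: subgroup_div|exact: (subgroup_div sgF)].
have vcK : virtually_cyclic K.
  apply: (quasimorphism_virtually_cyclic sgK
    (beta := busemann genS delta x) (D := 8 * delta)).
    by move=> g h [_ fg] _; exact: busemannM.
  move=> r; apply: sub_finite_set (busemann_finite hyp coh r).
  by move=> g [[_ ?] ?].
have [|nex] := pselect (exists2 a, H a & ~ fixes_end R genS x a); last first.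
  suff <- : K = H by [].
  apply/seteqP; split=> [g []//|g Hg]; split=> //.
  by apply: contrapT => nfg; apply: nex; exists g.
move=> [a Ha nfa]; apply: (index2_virtually_cyclic sgH sgK) vcK => [g []//|].
instantiate (1 := a) => h Hh.
have [|nfh] := pselect (fixes_end R genS x h); [by left|right].
split; first by apply: (subgroupM sgH) => //; exact: subgroupV.
apply: (fixes_end_meet hyp coh) => n.
(* the shadows are eventually disjoint from their translates by [a] and by [h], so
   that these translates meet each other *)
have disj g : ~ fixes_end R genS x g -> exists n, forall k, (n <= k)%N ->
    ~ exists2 v, shadow genS (x k) (k%:R : R) v &
        shadow genS (x k) (k%:R : R) (g * v)%g.
  move=> nfg; apply: contra_notP nfg => nex; apply: (fixes_end_meet hyp coh) => i.
  by apply: contrapT => ni; apply: nex; exists i => k ik vk; apply: ni; exists k.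
have [na da] := disj _ nfa; have [nh dh] := disj _ nfh.
pose k := maxn n (maxn na nh); exists k; first exact: leq_maxl.
have {}da := da k (leq_trans (leq_maxl _ _) (leq_maxr _ _)).
have {}dh := dh k (leq_trans (leq_maxr _ _) (leq_maxr _ _)).
pose s := shadow genS (x k) (k%:R : R).
pose sa := [set y | s (a^-1 * y)%g]; pose sh := [set y | s (h^-1 * y)%g].
have msa : 2^-1 <= m sa by rewrite minv; [exact: mx|exact: subgroupV].
have msh : 2^-1 <= m sh by rewrite minv; [exact: mx|exact: subgroupV].
have [[v [sv av]]|[v [sv hv]]|[v [av hv]]] := mean_three fam (mx k) msa msh.
- by exfalso; apply: da; exists (a^-1 * v)%g => //; rewrite mulVKg.
- by exfalso; apply: dh; exists (h^-1 * v)%g => //; rewrite mulVKg.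
by exists (h^-1 * v)%g => //; rewrite -mulgA mulVKg.
Qed.

(** * Positive unital functionals on bounded functions *)

Section mean_functionals.
Variable R : realType.
Implicit Types T : Type.

(** The bound holds everywhere, not almost everywhere: expectations are compared
    below as functionals on all bounded functions of a discrete space. *)
Definition bfun T (f : T -> R) := exists B, forall x, `|f x| <= B.

Lemma bfun_cst T (c : R) : bfun (fun _ : T => c).
Proof. by exists `|c|. Qed.

Lemma bfunD T (f g : T -> R) : bfun f -> bfun g -> bfun (fun x => f x + g x).
Proof.
move=> [A fA] [B gB]; exists (A + B) => x.
by apply: le_trans (ler_normD _ _) _; rewrite lerD.
Qed.

Lemma bfunM T (f g : T -> R) : bfun f -> bfun g -> bfun (fun x => f x * g x).
Proof.
move=> [A fA] [B gB]; exists (A * B) => x.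
by rewrite normrM ler_pM.
Qed.

Lemma bfunN T (f : T -> R) : bfun f -> bfun (fun x => - f x).
Proof. by move=> [A fA]; exists A => x; rewrite normrN. Qed.

Lemma bfun_comp T T' (f : T -> R) (a : T' -> T) : bfun f -> bfun (fun x => f (a x)).
Proof. by move=> [A fA]; exists A. Qed.

Lemma bfun01 T (f : T -> R) : (forall x, 0 <= f x <= 1) -> bfun f.
Proof. by move=> f01; exists 1 => x; have /andP[? ?] := f01 x; rewrite ger0_norm. Qed.

Lemma bfun_indic T (A : set T) : bfun (\1_A : T -> R).
Proof. by apply: bfun01 => x; rewrite indicE ler0n lern1 leq_b1. Qed.

Record mean_functional T (P : (T -> R) -> R) : Prop := MeanFunctional {
  meanD : forall f g, bfun f -> bfun g ->
    P (fun x => f x + g x) = P f + P g ;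
  meanZ : forall c f, bfun f -> P (fun x => c * f x) = c * P f ;
  mean_ge0 : forall f, bfun f -> (forall x, 0 <= f x) -> 0 <= P f ;
  mean1 : P (fun=> 1) = 1 }.

Section theory.
Variables (T : Type) (P : (T -> R) -> R).
Hypothesis mP : mean_functional P.
Implicit Types f g : T -> R.

Lemma mean_cst c : P (fun=> c) = c.
Proof.
have := meanZ mP c (bfun_cst T 1); rewrite (mean1 mP) mulr1 => Pc.
by rewrite -[RHS]Pc; congr P; apply/funext => x; rewrite mulr1.
Qed.

Lemma meanB f g : bfun f -> bfun g -> P (fun x => f x - g x) = P f - P g.
Proof.
move=> bf bg; have := meanZ mP (-1) bg; rewrite mulN1r => <-.
rewrite -(meanD mP) //; last exact: bfunM (bfun_cst _ _) bg.
by congr P; apply/funext => x; rewrite mulN1r.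
Qed.

Lemma mean_mono f g : bfun f -> bfun g -> (forall x, f x <= g x) -> P f <= P g.
Proof.
move=> bf bg fg; rewrite -subr_ge0 -meanB//.
apply: (mean_ge0 mP) => [|x]; last by rewrite subr_ge0.
exact: bfunD bg (bfunN bf).
Qed.

Lemma mean_norm f c : (forall x, `|f x| <= c) -> `|P f| <= c.
Proof.
move=> fc; have bf : bfun f by exists c.
have fc' x : - c <= f x <= c by rewrite -ler_norml.
rewrite ler_norml -(mean_cst (- c)) -{2}(mean_cst c).
apply/andP; split; apply: mean_mono => //; try exact: bfun_cst.
all: by move=> x; have /andP[] := fc' x.
Qed.

Lemma mean_norm_le f g : bfun g -> (forall x, `|f x| <= g x) -> `|P f| <= P g.
Proof.
move=> bg fg; have fg' x : - g x <= f x <= g x by rewrite -ler_norml.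
have bf : bfun f.
  have [B gB] := bg; exists B => x; apply: le_trans (fg x) _.
  exact: le_trans (ler_norm _) (gB x).
rewrite ler_norml -mulN1r -(meanZ mP)//; apply/andP; split.
  apply: mean_mono => // [|x]; first exact: bfunM (bfun_cst _ _) bg.
  by rewrite mulN1r; have /andP[] := fg' x.
by apply: mean_mono => // x; have /andP[] := fg' x.
Qed.

End theory.

Lemma mean_functional_comp T T' (a : T' -> T) (P : (T' -> R) -> R) :
  mean_functional P -> mean_functional (fun f : T -> R => P (fun x => f (a x))).
Proof.
move=> mP; split=> [f g bf bg|c f bf|f bf f0|].
- by rewrite (meanD mP)//; exact: bfun_comp.
- by rewrite (meanZ mP)//; exact: bfun_comp.
- by apply: (mean_ge0 mP) => //; exact: bfun_comp.
- exact: mean1.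
Qed.

Lemma bfun_mean T T' (P : (T -> R) -> R) (f : T' -> T -> R) :
  mean_functional P -> (exists B, forall x y, `|f x y| <= B) ->
  bfun (fun x => P (f x)).
Proof.
by move=> mP [B fB]; exists B => x; apply: (mean_norm mP) => y.
Qed.

Lemma mean_functional_prod T T' (P : (T -> R) -> R) (Q : (T' -> R) -> R) :
  mean_functional P -> mean_functional Q ->
  mean_functional (fun f : T * T' -> R => P (fun x => Q (fun y => f (x, y)))).
Proof.
move=> mP mQ.
have bQ (f : T * T' -> R) : bfun f -> bfun (fun x => Q (fun y => f (x, y))).
  by move=> [B fB]; apply: (bfun_mean mQ); exists B.
have bf_ (f : T * T' -> R) x : bfun f -> bfun (fun y => f (x, y)).
  exact: bfun_comp.
split=> [f g bf bg|c f bf|f bf f0|].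
- rewrite -(meanD mP (bQ _ bf) (bQ _ bg)); congr P; apply/funext => x.
  by rewrite (meanD mQ)//; exact: bf_.
- rewrite -(meanZ mP _ (bQ _ bf)); congr P; apply/funext => x.
  by rewrite (meanZ mQ)//; exact: bf_.
- apply: (mean_ge0 mP) => [|x]; first exact: bQ.
  by apply: (mean_ge0 mQ) => //; exact: bf_.
- by rewrite -[RHS](mean1 mP); congr P; apply/funext => x; rewrite (mean1 mQ).
Qed.

Lemma mean_functional_mix T (p : R) (P Q : (T -> R) -> R) :
  0 <= p <= 1 -> mean_functional P -> mean_functional Q ->
  mean_functional (fun f => p * P f + (1 - p) * Q f).
Proof.
move=> /andP[p0 p1] mP mQ; split=> [f g bf bg|c f bf|f bf f0|].
- by rewrite (meanD mP)// (meanD mQ)//; lra.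
- by rewrite (meanZ mP)// (meanZ mQ)//; lra.
- rewrite addr_ge0// mulr_ge0 ?subr_ge0//; first exact: mean_ge0.
  exact: (mean_ge0 mQ).
- by rewrite (mean1 mP) (mean1 mQ); lra.
Qed.

(** Halving trick: a function with values in the unit interval is half the sum of
    the indicator of the set where it is at least one half, and of another function
    with values in the unit interval. So the distance between two functionals on
    such functions is at most half its bound on indicators plus half itself. *)
Lemma mean_close T (P Q : (T -> R) -> R) (e : R) :
  mean_functional P -> mean_functional Q ->
  (forall A : set T, `|P \1_A - Q \1_A| <= e) ->
  forall f, (forall x, 0 <= f x <= 1) -> `|P f - Q f| <= e.
Proof.
move=> mP mQ PQe.
have approx n f : (forall x, 0 <= f x <= 1) -> `|P f - Q f| <= e + 2^-1 ^+ n.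
  elim: n f => [|n IHn] f f01.
    have e0 : 0 <= e by exact: le_trans (PQe set0).
    have bf := bfun01 f01; have f0 x : 0 <= f x by have /andP[] := f01 x.
    have f1 x : f x <= 1 by have /andP[] := f01 x.
    have := mean_mono mP bf (bfun_cst _ 1) f1; rewrite (mean1 mP).
    have := mean_mono mQ bf (bfun_cst _ 1) f1; rewrite (mean1 mQ).
    have := mean_ge0 mP bf f0; have := mean_ge0 mQ bf f0.
    by rewrite expr0 ler_norml => ? ? ? ?; apply/andP; split; lra.
  pose A := [set x | 2^-1 <= f x]; pose g x := 2 * f x - \1_A x.
  have g01 x : 0 <= g x <= 1.
    rewrite /g indicE; have /andP[fx0 fx1] := f01 x.
    have [xA|xA] := boolP (x \in A).
      by move: xA; rewrite inE /A /= => xA; apply/andP; split; lra.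
    have : f x < 2^-1 by move: xA; rewrite notin_setE /A /= ltNge => /negP.
    by rewrite mulr0n => ?; apply/andP; split; lra.
  have bg := bfun01 g01; have bA := bfun_indic A.
  have fE : f = (fun x => 2^-1 * (\1_A x + g x)).
    by apply/funext => x; rewrite /g; lra.
  have := IHn _ g01; have := PQe A.
  have bAg := bfunD bA bg.
  rewrite fE (meanZ mP _ bAg) (meanZ mQ _ bAg) (meanD mP bA bg) (meanD mQ bA bg).
  rewrite exprS.
  by rewrite !ler_norml => /andP[? ?] /andP[? ?]; apply/andP; split; lra.
move=> f f01; apply/ler_addgt0Pr => d d0.
have cvg0 : (2^-1 : R) ^+ n @[n --> \oo] --> (0 : R).
  by apply: cvg_expr; rewrite ger0_norm ?invr_ge0//; lra.
have [n nd] := filter_ex (cvgr_lt _ cvg0 d d0).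
by apply: le_trans (approx n _ f01) _; rewrite lerD2l ltW.
Qed.

(** Means that agree on indicators agree on bounded functions. This replaces Fubini
    and change of variables: each formula for an expectation has to be checked on
    indicators only, where it is the definition of the law. *)
Lemma mean_ext T (P Q : (T -> R) -> R) :
  mean_functional P -> mean_functional Q ->
  (forall A : set T, P \1_A = Q \1_A) -> forall f, bfun f -> P f = Q f.
Proof.
move=> mP mQ PQ f [B fB].
have PQ01 g : (forall x, 0 <= g x <= 1) -> P g = Q g.
  move=> g01; apply/eqP; rewrite -subr_eq0 -normr_le0.
  by apply: (mean_close mP mQ) => // A; rewrite PQ subrr normr0.
pose C := `|B| + 1; have C0 : 0 < C by rewrite ltr_wpDl.
pose g x := (f x + C) / (2 * C).
have g01 x : 0 <= g x <= 1.
  have : `|f x| <= C by apply: le_trans (fB x) _; rewrite ler_wpDr// ler_norm.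
  rewrite ler_norml /g ler_pdivlMr ?ler_pdivrMr ?mulr_gt0// => /andP[? ?].
  by apply/andP; split; lra.
have bg := bfun01 g01.
have fE : f = (fun x => 2 * C * g x + - C).
  by apply/funext => x; rewrite /g mulrC divfK ?addrK// mulf_neq0 ?gt_eqF.
have bCg := bfunM (bfun_cst T (2 * C)) bg; have bC := bfun_cst T (- C).
rewrite fE (meanD mP bCg bC) (meanD mQ bCg bC) (meanZ mP _ bg) (meanZ mQ _ bg).
by rewrite (mean_cst mP) (mean_cst mQ) PQ01.
Qed.

End mean_functionals.

(** * Expectations with respect to laws on discrete groups *)

Section expectation.
Variable R : realType.
Implicit Types G H : groupType.

Definition expect G (nu : probability (discr G) R) (f : G -> R) : R :=
  \int[nu]_x (f x : R).

Lemma discr_integrable G (nu : probability (discr G) R) (f : discr G -> R) :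
  bfun f -> nu.-integrable setT (EFin \o f).
Proof.
move=> [B fB]; apply: measurable_bounded_integrable => //.
- by rewrite [X in (X < _)%E](@probability_setT _ _ R nu) ltry.
- exists B; split; first exact: num_real.
  by move=> M BM x _; apply: le_trans (fB x) (ltW BM).
Qed.

Lemma expect_mean G (nu : probability (discr G) R) : mean_functional (expect nu).
Proof.
split=> [f g bf bg|c f bf|f bf f0|].
- by rewrite /expect RintegralD//; exact: discr_integrable.
- by rewrite /expect RintegralZl//; exact: discr_integrable.
- by apply: Rintegral_ge0 => x _.
- rewrite /expect [LHS](@Rintegral_cst _ (discr G) R nu)// mul1r.
  by rewrite [X in fine X](@probability_setT _ _ R nu).
Qed.

Lemma expect_indic G (nu : probability (discr G) R) (A : set G) :
  expect nu \1_A = fine (nu A).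
Proof. by rewrite /expect /Rintegral integral_indic// setIT. Qed.

Lemma expect_dirac G (a : G) (f : G -> R) : bfun f ->
  expect (\d_(a : discr G)) f = f a.
Proof.
by move=> bf; rewrite /expect /Rintegral integral_dirac ?diracT ?mul1e//.
Qed.

Lemma expect_product G H (mu : probability (discr G) R)
    (nu : probability (discr H) R) (F : G * H -> R) : bfun F ->
  expect (product_law mu nu) F = expect mu (fun x => expect nu (fun y => F (x, y))).
Proof.
move: F; apply: mean_ext; first exact: expect_mean.
  exact: mean_functional_prod (expect_mean mu) (expect_mean nu).
move=> A; rewrite expect_indic /expect /Rintegral; congr fine.
apply: eq_integral => x _ /=.
have -> : (fun y => (\1_A (x, y))%:E) = (fun y => (\1_(xsection A x) y)%:E : \bar R).
  by apply/funext => y; rewrite !indicE mem_xsection.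
by rewrite integral_indic// setIT fineK// fin_num_measure.
Qed.

Lemma expect_convolution G (mu nu : probability (discr G) R) (f : G -> R) :
  bfun f -> expect (convolution mu nu) f =
    expect mu (fun x => expect nu (fun y => f (x * y)%g)).
Proof.
move: f; apply: mean_ext; first exact: expect_mean.
  have := mean_functional_prod (expect_mean mu) (expect_mean nu).
  exact: (mean_functional_comp (fun xy => (xy.1 * xy.2)%g)).
move=> A; rewrite expect_indic.
have bA := bfun_comp (fun xy : G * G => (xy.1 * xy.2)%g) (bfun_indic R A).
rewrite -[RHS](expect_product mu nu bA).
rewrite -[RHS]/(expect (product_law mu nu) \1_[set xy | A (xy.1 * xy.2)%g]).
by rewrite expect_indic.
Qed.

Lemma expect_diagonal G (mu : probability (discr G) R) (F : G * G -> R) :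
  bfun F -> expect (diagonal_law mu) F = expect mu (fun x => F (x, x)).
Proof.
move: F; apply: mean_ext; first exact: expect_mean.
  exact: (mean_functional_comp (fun x => (x, x))) (expect_mean mu).
move=> A; rewrite expect_indic.
rewrite -[RHS]/(expect mu \1_[set x | A (x, x)]).
by rewrite expect_indic.
Qed.

Lemma expect_noisy G (mu : probability (discr G) R) (rho : {i01 R})
    (F : G * G -> R) : bfun F ->
  expect (noisy_law mu rho) F =
    rho%:num * expect mu (fun x => expect mu (fun y => F (x, y))) +
    (1 - rho%:num) * expect mu (fun x => F (x, x)).
Proof.
move=> bF; rewrite -expect_product// -expect_diagonal//.
move: F bF; apply: mean_ext; first exact: expect_mean.
  apply: mean_functional_mix; [|exact: expect_mean|exact: expect_mean].
  by apply/andP; split.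
move=> A; rewrite !expect_indic [X in fine X = _](mixtureE rho (product_law mu mu)).
by rewrite fineD ?fineM// ?fin_numM// fin_num_measure.
Qed.

Lemma tv_dist_expect G (mu nu : probability (discr G) R) (e : R) :
  (tv_dist mu nu <= e%:E)%E -> forall f : G -> R,
  (forall x, 0 <= f x <= 1) -> `|expect mu f - expect nu f| <= e.
Proof.
move=> tve; apply: mean_close; [exact: expect_mean|exact: expect_mean|].
move=> A; rewrite !expect_indic -lee_fin; apply: le_trans tve.
apply: ereal_sup_ubound; exists A => //.
by rewrite -[mu A]fineK ?fin_num_measure// -[nu A]fineK ?fin_num_measure.
Qed.

End expectation.

(** * Harmonic functions and the noisy walk *)

Lemma bfun_translates (R : realType) (G : groupType) (nu : probability (discr G) R)
    (f : G -> R) : bfun f -> bfun (fun x => expect nu (fun y => f (x * y)%g)).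
Proof.
by move=> [B fB]; apply: bfun_mean; [exact: expect_mean|exists B].
Qed.

Lemma expect_power_succ (R : realType) (G : groupType) (mu : probability (discr G) R)
    n (f : G -> R) : bfun f -> expect (convolution_power mu n.+1) f =
  expect (convolution_power mu n) (fun x => expect mu (fun y => f (x * y)%g)).
Proof. exact: expect_convolution. Qed.

(** The convolution powers are built by multiplying on the right; associativity
    allows the first step of the walk to be singled out instead. *)
Lemma expect_power_succl (R : realType) (G : groupType) (mu : probability (discr G) R)
    n (f : G -> R) : bfun f -> expect (convolution_power mu n.+1) f =
  expect mu (fun x => expect (convolution_power mu n) (fun y => f (x * y)%g)).
Proof.
have bfl (k : G -> R) x : bfun k -> bfun (fun y => k (x * y)%g) by exact: bfun_comp.
elim: n f => [|n IHn] f bf; rewrite expect_power_succ//.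
  rewrite expect_dirac; last exact: bfun_translates.
  congr (expect mu); apply/funext => x; rewrite expect_dirac ?mul1g ?mulg1//.
  exact: bfl.
rewrite IHn; last exact: bfun_translates.
congr (expect mu); apply/funext => x; rewrite expect_power_succ; last exact: bfl.
congr expect; apply/funext => y; congr (expect mu); apply/funext => z.
by rewrite mulgA.
Qed.

Section noisy_marginals.
Variables (R : realType) (G : groupType) (mu : probability (discr G) R).
Variable rho : {i01 R}.

Lemma noisy_fst (f : G -> R) : bfun f ->
  expect (noisy_law mu rho) (fun z => f z.1) = expect mu f.
Proof.
move=> bf; rewrite expect_noisy; last exact: (bfun_comp fst).
have -> : (fun x : G => expect mu (fun=> f x)) = f.
  by apply/funext => x; rewrite /= (mean_cst (expect_mean mu)).
by rewrite -mulrDl [rho%:num + _]addrC subrK mul1r.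
Qed.

Lemma noisy_snd (f : G -> R) : bfun f ->
  expect (noisy_law mu rho) (fun z => f z.2) = expect mu f.
Proof.
move=> bf; rewrite expect_noisy; last exact: (bfun_comp snd).
rewrite /= (mean_cst (expect_mean mu)).
by rewrite -mulrDl [rho%:num + _]addrC subrK mul1r.
Qed.

Lemma noisy_power_fst n (f : G -> R) : bfun f ->
  expect (convolution_power (noisy_law mu rho) n) (fun z => f z.1) =
  expect (convolution_power mu n) f.
Proof.
elim: n f => [|n IHn] f bf; first by rewrite !expect_dirac//; exact: (bfun_comp fst).
rewrite !expect_power_succ//; last exact: (bfun_comp fst).
rewrite -IHn; last exact: bfun_translates.
congr expect; apply/funext => z; apply: (noisy_fst (f := fun u => f (z.1 * u)%g)).
exact: bfun_comp.
Qed.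

Lemma noisy_power_snd n (f : G -> R) : bfun f ->
  expect (convolution_power (noisy_law mu rho) n) (fun z => f z.2) =
  expect (convolution_power mu n) f.
Proof.
elim: n f => [|n IHn] f bf; first by rewrite !expect_dirac//; exact: (bfun_comp snd).
rewrite !expect_power_succ//; last exact: (bfun_comp snd).
rewrite -IHn; last exact: bfun_translates.
congr expect; apply/funext => z; apply: (noisy_snd (f := fun u => f (z.2 * u)%g)).
exact: bfun_comp.
Qed.

End noisy_marginals.

Section harmonic.
Variables (R : realType) (G : groupType) (mu : probability (discr G) R).
Variables (rho : {i01 R}) (h : G -> R).
Hypothesis h01 : forall x, 0 <= h x <= 1.
Hypothesis harm : forall g, expect mu (fun x => h (g * x)%g) = h g.

Let mE := expect_mean mu.
Let bh : bfun h := bfun01 h01.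
Let bhl x : bfun (fun u => h (x * u)%g) := bfun_comp _ bh.
#[local] Hint Resolve bfun_cst bfunD bfunM bfunN bh bhl : core.

(** Conditional covariance of the increments of [h] along two walks standing at [x]
    and [y] when both make the same step. *)
Definition increment_cov x y : R :=
  expect mu (fun u => (h (x * u)%g - h x) * (h (y * u)%g - h y)).

Lemma increment_covE x y : increment_cov x y =
  expect mu (fun u => h (x * u)%g * h (y * u)%g) - h x * h y.
Proof.
have -> : increment_cov x y = expect mu (fun u => h (x * u)%g * h (y * u)%g +
    ((- h y) * h (x * u)%g + ((- h x) * h (y * u)%g + h x * h y))).
  by congr expect; apply/funext => u; lra.
rewrite !(meanD mE) ?(meanZ mE) ?(mean_cst mE) ?harm; auto.
lra.
Qed.

Let F (z : G * G) := h z.1 * h z.2.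
Let mun n := convolution_power mu n.
Let pin n := convolution_power (noisy_law mu rho) n.
Let q n := expect (mun n) (fun x => h x * h x).

Let F01 z w : 0 <= F (z * w)%g <= 1.
Proof.
have /andP[a0 a1] := h01 (z * w)%g.1; have /andP[b0 b1] := h01 (z * w)%g.2.
by rewrite /F mulr_ge0//= mulr_ile1.
Qed.

Let bF : bfun F.
Proof. by apply: bfun01 => z; rewrite -[z]mul1g F01. Qed.

(** One step of the pair of walks multiplies both by independent steps with
    probability [rho], which by harmonicity leaves [F] unchanged on average, and
    by a common step otherwise, which adds the covariance of the increments. *)
Lemma noisy_step z : expect (noisy_law mu rho) (fun w => F (z * w)%g) =
  F z + (1 - rho%:num) * increment_cov z.1 z.2.
Proof.
rewrite expect_noisy; last exact: bfun_comp.
rewrite /F /= increment_covE.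
have -> : (fun x => expect mu (fun y => h (z.1 * x)%g * h (z.2 * y)%g)) =
    (fun x => h z.2 * h (z.1 * x)%g).
  by apply/funext => x; rewrite (meanZ mE)// harm mulrC.
by rewrite (meanZ mE)// harm; lra.
Qed.

Let V x := increment_cov x x.

Let bV : bfun V.
Proof.
exists 1 => x; apply: (mean_norm mE) => u; rewrite normrM mulr_ile1//.
all: have /andP[? ?] := h01 x; have /andP[? ?] := h01 (x * u)%g.
all: by rewrite ler_norml; apply/andP; split; lra.
Qed.
#[local] Hint Resolve bV : core.

Lemma increment_cov_le x y : `|increment_cov x y| <= 2^-1 * (V x + V y).
Proof.
have bi z : bfun (fun u => h (z * u)%g - h z) by auto.
have bb : bfun (fun u => 2^-1 * ((h (x * u)%g - h x) * (h (x * u)%g - h x) +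
  (h (y * u)%g - h y) * (h (y * u)%g - h y))) by auto 10.
have -> : 2^-1 * (V x + V y) = expect mu (fun u => 2^-1 *
    ((h (x * u)%g - h x) * (h (x * u)%g - h x) +
     (h (y * u)%g - h y) * (h (y * u)%g - h y))).
  by rewrite (meanZ mE) ?(meanD mE); auto.
rewrite ler_norml; apply/andP; split; last first.
  apply: (mean_mono mE) => // [|u]; first by auto.
  by have := sqr_ge0 (h (x * u)%g - h x - (h (y * u)%g - h y)); rewrite expr2; lra.
rewrite lerNl -mulN1r /increment_cov -(meanZ mE); last by auto.
apply: (mean_mono mE) => // [|u]; first by auto.
by have := sqr_ge0 (h (x * u)%g - h x + (h (y * u)%g - h y)); rewrite expr2; lra.
Qed.

Lemma sqnorm_step n : q n.+1 = q n + expect (mun n) V.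
Proof.
rewrite /q expect_power_succ; last by auto.
rewrite -(meanD (expect_mean _)); auto.
congr expect; apply/funext => x; rewrite /V increment_covE; lra.
Qed.

Let a n := expect (pin n) F.

(** Each walk of the pair, taken alone, has law [mun n], so the conditional
    variances that dominate the covariance average to the increment of [q]. *)
Lemma noisy_increment n : `|a n.+1 - a n| <= q n.+1 - q n.
Proof.
rewrite sqnorm_step addrAC subrr add0r.
rewrite {1}/a expect_power_succ; last exact: bF.
have b1 := bfun_translates (noisy_law mu rho) bF.
rewrite /a -(meanB (expect_mean _))//.
have -> : expect (mun n) V = expect (pin n) (fun z => 2^-1 * (V z.1 + V z.2)).
  rewrite (meanZ (expect_mean _)); last by apply: bfunD; apply: bfun_comp.
  rewrite (meanD (expect_mean _)); [|exact: bfun_comp..].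
  by rewrite noisy_power_fst// noisy_power_snd//; lra.
have rho01 : 0 <= rho%:num <= 1 by apply/andP; split.
apply: (mean_norm_le (expect_mean _)) => [|z].
  by apply: bfunM => //; apply: bfunD; exact: bfun_comp.
rewrite noisy_step [F z + _]addrC addrK normrM.
have /andP[r0 r1] := rho01; apply: le_trans (increment_cov_le _ _).
by rewrite ler_piMl// ger0_norm; lra.
Qed.

(** The values of [h] along the walk form a bounded martingale: its second moments
    increase and converge. *)
Lemma sqnorm_increment_small e : 0 < e ->
  exists N, forall n, (N <= n)%N -> q n.+1 - q n <= e.
Proof.
move=> e0.
have q1 n : q n <= 1.
  rewrite -[leRHS](mean1 (expect_mean (mun n))).
  apply: (mean_mono (expect_mean _)) => // [|x].
    by auto.
  by have /andP[? ?] := h01 x; rewrite mulr_ile1.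
have V0 x : 0 <= V x.
  by apply: (mean_ge0 mE) => [|u]; [auto|rewrite -expr2 sqr_ge0].
have qcvg : cvgn q.
  apply: nondecreasing_is_cvgn.
    apply/nondecreasing_seqP => n; rewrite sqnorm_step lerDl.
    exact: (mean_ge0 (expect_mean _)).
  by exists 1 => _ [n _ <-].
have q0 : (q n.+1 - q n) @[n --> \oo] --> (0 : R).
  rewrite -(subrr (limn q)); apply: cvgB => //.
  by rewrite (cvg_shiftS q).
have [N _ NP] := cvgr_le _ q0 _ e0.
by exists N => n Nn; exact: NP.
Qed.

Lemma harmonic_power n x : expect (mun n) (fun u => h (x * u)%g) = h x.
Proof.
elim: n => [|n IHn]; first by rewrite expect_dirac ?mulg1; auto.
rewrite expect_power_succ; last by auto.
rewrite -[RHS]IHn; congr expect; apply/funext => u; rewrite -[RHS]harm.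
by congr expect; apply/funext => v; rewrite mulgA.
Qed.

Hypothesis rho_lt1 : rho%:num < 1.
Hypothesis tv0 : forall e, 0 < e -> forall N, exists2 n, (N <= n)%N &
  (tv_dist (pin n) (product_law (mun n) (mun n)) <= e%:E)%E.

(** If the noisy law is close to the product law at some large time [n], then
    the [n]-step average of [F] from any starting point [z] is close to [F z].
    Taking one more step first shows that [F] is nearly harmonic at [1] for the
    pair of walks, while [noisy_step] computes its defect, [(1 - rho) * V 1]. *)
Lemma harmonic_invariant1 : V 1%g = 0.
Proof.
apply/eqP; rewrite eq_le; apply/andP; split; last first.
  by apply: (mean_ge0 mE) => [|u]; [auto|rewrite -expr2 sqr_ge0].
rewrite -(pmulr_rle0 (x := 1 - rho%:num)) ?subr_gt0//.
apply/ler_addgt0Pr => e e0; rewrite add0r.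
have e3 : 0 < e / 3 by lra.
have [N qN] := sqnorm_increment_small e3.
have [n Nn tvn] := tv0 e3 N.
have closez z : `|expect (pin n) (fun w => F (z * w)%g) - F z| <= e / 3.
  have -> : F z = expect (product_law (mun n) (mun n)) (fun w => F (z * w)%g).
    rewrite expect_product; last exact: bfun_comp.
    have -> : (fun x => expect (mun n) (fun y => F (z * (x, y))%g)) =
        (fun x => h z.2 * h (z.1 * x)%g).
      apply/funext => x; rewrite /F /= (meanZ (expect_mean _)); last by auto.
      by rewrite harmonic_power mulrC.
    rewrite (meanZ (expect_mean _)); last by auto.
    by rewrite harmonic_power mulrC.
  exact: tv_dist_expect tvn _ (F01 z).
have := closez 1%g; have := noisy_increment n; have := qN n Nn.
have : `|a n.+1 - expect (noisy_law mu rho) F| <= e / 3.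
  rewrite /a expect_power_succl// -(meanB (expect_mean _)); last 2 first.
  - exact: bfun_translates.
  - by [].
  by apply: (mean_norm (expect_mean _)) => z; exact: closez.
have F1 : (fun w => F (1 * w)%g) = F by apply/funext => w; rewrite mul1g.
have := noisy_step 1%g; rewrite F1 /= -/(V 1%g) -/(a n) => ->.
by rewrite !ler_norml => /andP[? ?] ? /andP[? ?] /andP[? ?]; lra.
Qed.

Lemma harmonic_support1 x : law_support mu x -> h x = h 1%g.
Proof.
rewrite /law_support /= => mux.
have mux0 : 0 < fine (mu [set x]).
  rewrite fine_gt0// lt0e mux measure_ge0/=.
  by rewrite -ge0_fin_numE ?fin_num_measure.
apply/eqP; rewrite -subr_eq0 -sqrf_eq0 -(mulIr_eq0 _ (mulIf (lt0r_neq0 mux0))).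
rewrite eq_le; apply/andP; split; last by rewrite mulr_ge0 ?sqr_ge0 ?ltW.
rewrite -harmonic_invariant1 -expect_indic -(meanZ mE); last exact: bfun_indic.
apply: (mean_mono mE) => // [||u].
- exact: bfunM (bfun_cst _ _) (bfun_indic _ _).
- by auto.
rewrite indicE; have [|] := boolP (u \in _); last first.
  by rewrite mulr0 -expr2 sqr_ge0.
by rewrite inE /= => ->; rewrite mulr1 mul1g expr2.
Qed.

End harmonic.

(** Asymptotic independence of the pair forces bounded harmonic functions to be
    invariant under the support of the law: the translates of [h] are harmonic too,
    so that the variance of one step vanishes at every point. *)
Lemma harmonic_support (R : realType) (G : groupType) (mu : probability (discr G) R)
    (rho : {i01 R}) (h : G -> R) :
  (forall x, 0 <= h x <= 1) ->
  (forall g, expect mu (fun x => h (g * x)%g) = h g) ->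
  rho%:num < 1 ->
  (forall e, 0 < e -> forall N, exists2 n, (N <= n)%N &
    (tv_dist (convolution_power (noisy_law mu rho) n)
      (product_law (convolution_power mu n) (convolution_power mu n)) <= e%:E)%E) ->
  forall g x, law_support mu x -> h (g * x)%g = h g.
Proof.
move=> h01 harm rho1 tv0 g x mux.
rewrite (@harmonic_support1 _ _ mu rho (fun x => h (g * x)%g))// ?mulg1// => k.
by rewrite -[RHS]harm; congr expect; apply/funext => u; rewrite mulgA.
Qed.

(** * Stationary means *)

Lemma tightness (R : realType) (G : groupType) (S : seq G) (nu : probability (discr G) R)
    (e : R) : generating S -> 0 < e ->
  exists2 K : set G, finite_set K & expect nu \1_(~` K) <= e.
Proof.
move=> genS e0; pose B n : set (discr G) := [set x | (word_norm genS x <= n)%N].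
have Bcvg : nu (B n) @[n --> \oo] --> (1 : \bar R)%E.
  rewrite -(@probability_setT _ _ _ nu).
  have -> : setT = \bigcup_n B n.
    by apply/seteqP; split=> // x _; exists (word_norm genS x); rewrite // /B /=.
  apply: nondecreasing_cvg_mu => //; apply/nondecreasing_seqP => n.
  by apply/subsetPset => x /=; exact: leqW.
have e1 : 1 - e < 1 by lra.
have [n /ltW nB] := filter_ex (cvgr_gt _ (fine_cvg Bcvg) _ e1).
exists (B n); first exact: finite_word_ball.
have -> : \1_(~` B n) = (fun x => 1 - \1_(B n) x) :> (G -> R).
  by apply/funext => x; rewrite !indicE in_setC; case: (x \in _); rewrite ?subrr ?subr0.
rewrite (meanB (expect_mean _)); [|exact: bfun_cst|exact: bfun_indic].
by rewrite (mean_cst (expect_mean _)) expect_indic; move: nB => /=; lra.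
Qed.

(** Dominated convergence along an arbitrary proper filter, where countable
    additivity is not enough: pointwise convergence is uniform on a finite set that
    carries almost all the mass, and the bound [B] controls the rest. *)
Lemma expect_cvg (R : realType) (G : groupType) (S : seq G)
    (nu : probability (discr G) R) (I : Type) (F : set_system I) (B : R)
    (u : I -> G -> R) (l : G -> R) : generating S -> ProperFilter F ->
  (forall i x, `|u i x| <= B) -> (forall x, u i x @[i --> F] --> l x) ->
  expect nu (u i) @[i --> F] --> expect nu l.
Proof.
move=> genS FF uB ul.
have lB x : `|l x| <= B.
  by apply: cvgr_to_le (cvg_norm (ul x)) _; exact: nearW.
have mE := expect_mean nu.
have B0 : 0 <= B by apply: le_trans (lB 1%g).
apply/cvgrPdist_le => e e0.
have d0 : 0 < e / 2 / (2 * B + 1) by rewrite !divr_gt0// ltr_wpDl// mulr_ge0.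
have [K /finite_fsetP[L KL] nuK] := tightness nu genS d0.
have e20 : 0 < e / 2 by lra.
have : \forall i \near F, forall x, x \in L -> `|l x - u i x| <= e / 2.
  apply: near_all_seq => x xL.
  by have /cvgrPdist_le := ul x; apply.
apply: filterS => i uiL.
have bl : bfun l by exists B.
have bu : bfun (u i) by exists B.
have b1 : bfun (fun x => (2 * B) * \1_(~` K) x : R).
  exact: bfunM (bfun_cst _ _) (bfun_indic _ _).
rewrite -(meanB mE)//.
apply: (@le_trans _ _ (expect nu (fun x => e / 2 + (2 * B) * \1_(~` K) x))).
  apply: (mean_norm_le mE) => [|x]; first exact: bfunD (bfun_cst _ _) b1.
  have [xK|xK] := pselect (K x).
    rewrite indicE memNset//= mulr0 addr0; apply: uiL.
    by move: xK; rewrite KL.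
  rewrite indicE mem_set//= mulr1; apply: le_trans (ler_normB _ _) _.
  by have := lB x; have := uB i x; lra.
rewrite (meanD mE)//; last exact: bfun_cst.
rewrite (mean_cst mE) (meanZ mE); last exact: bfun_indic.
have : 2 * B * expect nu \1_(~` K) <= (2 * B + 1) * (e / 2 / (2 * B + 1)).
  apply: ler_pM => //; first by rewrite mulr_ge0.
    by apply: (mean_ge0 mE) => [|x]; [exact: bfun_indic|rewrite indicE ler0n].
  by rewrite lerDl.
by rewrite [X in _ <= X]mulrC divfK ?gt_eqF ?ltr_wpDl ?mulr_ge0//; lra.
Qed.

Section ultralimit.
Variables (R : realType) (T : Type) (P : nat -> (T -> R) -> R).
Variable U : set_system nat.
Hypotheses (UU : UltraFilter U) (mP : forall n, mean_functional (P n)).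

Lemma ultra_bounded_cvg (u : nat -> R) : bfun u -> cvg (u @ U).
Proof.
move=> [B uB].
have := @segment_compact R (- B) B; rewrite compact_ultra => cpt.
have [||l [_ ul]] := cpt (u @ U).
- exact: fmap_ultra.
- by apply: (@filterE _ U) => n; rewrite /= in_itv/= -ler_norml.
by apply/cvg_ex; exists l.
Qed.

Definition ulim (f : T -> R) : R := lim (P n f @[n --> U]).

Lemma ulim_cvg f : bfun f -> P n f @[n --> U] --> ulim f.
Proof.
move=> [B fB]; apply: ultra_bounded_cvg; exists B => n.
exact: (mean_norm (mP n)).
Qed.

Lemma ulim_mean : mean_functional ulim.
Proof.
split=> [f g bf bg|c f bf|f bf f0|].
- apply: cvg_lim => //.
  have -> : (fun n => P n (fun x => f x + g x)) = (fun n => P n f + P n g).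
    by apply/funext => n; rewrite (meanD (mP n)).
  by apply: cvgD; exact: ulim_cvg.
- apply: cvg_lim => //.
  have -> : (fun n => P n (fun x => c * f x)) = (fun n => c * P n f).
    by apply/funext => n; rewrite (meanZ (mP n)).
  by apply: cvgMr; exact: ulim_cvg.
- apply: cvgr_to_ge (ulim_cvg bf) _; apply: nearW => n.
  exact: (mean_ge0 (mP n)).
- apply: cvg_lim => //.
  have -> : (fun n => P n (fun=> 1)) = (fun=> 1).
    by apply/funext => n; rewrite (mean1 (mP n)).
  exact: cvg_cst.
Qed.

End ultralimit.

Lemma mean_sum (R : realType) (T : Type) (P : (T -> R) -> R) (f : nat -> T -> R) n :
  mean_functional P -> (forall k, bfun (f k)) ->
  P (fun x => \sum_(k < n) f k x) = \sum_(k < n) P (f k).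
Proof.
move=> mP bf; suff [_ ->] : bfun (fun x => \sum_(k < n) f k x) /\
  P (fun x => \sum_(k < n) f k x) = \sum_(k < n) P (f k) by [].
elim: n => [|n [bs IHn]].
  have -> : (fun x : T => \sum_(k < 0) f k x) = (fun=> 0).
    by apply/funext => x; rewrite big_ord0.
  by rewrite big_ord0 (mean_cst mP); split=> //; exact: bfun_cst.
have -> : (fun x => \sum_(k < n.+1) f k x) = (fun x => \sum_(k < n) f k x + f n x).
  by apply/funext => x; rewrite big_ord_recr.
by rewrite big_ord_recr /= (meanD mP)// IHn; split=> //; exact: bfunD.
Qed.

Lemma mean_functional_avg (R : realType) (T : Type) (P : nat -> (T -> R) -> R) n :
  (forall k, mean_functional (P k)) ->
  mean_functional (fun f => n.+1%:R^-1 * \sum_(k < n.+1) P k f).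
Proof.
move=> mP; split=> [f g bf bg|c f bf|f bf f0|].
- rewrite -mulrDr -big_split/=; congr (_ * _); apply: eq_bigr => k _.
  exact: (meanD (mP k)).
- rewrite [RHS]mulrCA [c * _]mulr_sumr; congr (_ * _); apply: eq_bigr => k _.
  exact: (meanZ (mP k)).
- rewrite mulr_ge0 ?invr_ge0 ?ler0n// sumr_ge0// => k _; exact: (mean_ge0 (mP k)).
- rewrite (eq_bigr (fun=> 1)) => [|k _]; last exact: (mean1 (mP k)).
  by rewrite sumr_const card_ord mulVf// pnatr_eq0.
Qed.

Section stationary.
Variables (R : realType) (G : groupType) (S : seq G) (mu : probability (discr G) R).
Hypothesis genS : generating S.
Variable U : set_system nat.
Hypotheses (UU : UltraFilter U) (sU : \oo `<=` U).

Definition cesaro n (f : G -> R) : R :=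
  n.+1%:R^-1 * \sum_(k < n.+1) expect (convolution_power mu k) f.

Lemma cesaro_mean n : mean_functional (cesaro n).
Proof.
exact: (mean_functional_avg n (fun k => expect_mean (convolution_power mu k))).
Qed.

Definition limit_mean := ulim cesaro U.

Lemma limit_mean_functional : mean_functional limit_mean.
Proof. exact: (ulim_mean UU cesaro_mean). Qed.

(** Cesaro averages of the laws of the walk are almost stationary: the two sums
    telescope. *)
Lemma expect_cesaro n (f : G -> R) : bfun f ->
  expect mu (fun x => cesaro n (fun y => f (x * y)%g)) = cesaro n f +
  n.+1%:R^-1 * (expect (convolution_power mu n.+1) f - f 1%g).
Proof.
move=> bf; pose E k := expect (convolution_power mu k).
rewrite /cesaro (meanZ (expect_mean mu)); last first.
  have [B fB] := bf; exists (\sum_(k < n.+1) B) => x.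
  apply: le_trans (ler_norm_sum _ _ _) _; apply: ler_sum => k _.
  by apply: (mean_norm (expect_mean _)) => y.
have bk k : bfun (fun x => E k (fun y => f (x * y)%g)) by exact: bfun_translates.
rewrite -mulrDr; congr (_ * _); rewrite (mean_sum _ (expect_mean mu) bk).
rewrite (eq_bigr (fun k : 'I_n.+1 => E k.+1 f)) => [|k _]; last first.
  by rewrite /E expect_power_succl.
have : f 1%g + \sum_(k < n.+1) E k.+1 f = \sum_(k < n.+1) E k f + E n.+1 f.
  have := @big_ord_recl R 0 +%R n.+1 (fun k : 'I_n.+2 => E k f).
  by rewrite big_ord_recr /= /E expect_dirac// => ->.
by rewrite /E; lra.
Qed.

(** The limit of the Cesaro averages is exactly stationary. Applied to the translates
    of a function, this says that their averages form a harmonic function. *)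
Lemma limit_mean_harmonic (f : G -> R) : bfun f ->
  expect mu (fun x => limit_mean (fun y => f (x * y)%g)) = limit_mean f.
Proof.
move=> bf; have [B fB] := bf.
have c1 : expect mu (fun x => cesaro n (fun y => f (x * y)%g)) @[n --> U] -->
    expect mu (fun x => limit_mean (fun y => f (x * y)%g)).
  apply: (expect_cvg (B := B) genS) => [n x|x].
    by apply: (mean_norm (cesaro_mean n)) => y.
  by apply: (ulim_cvg UU cesaro_mean); exact: bfun_comp.
have c2 : cesaro n f + n.+1%:R^-1 *
    (expect (convolution_power mu n.+1) f - f 1%g) @[n --> U] --> limit_mean f + 0.
  apply: cvgD; first exact: (ulim_cvg UU cesaro_mean bf).
  apply: cvg_trans (cvg_app _ sU) _.
  apply: (@squeeze_cvgr _ _ _ _ (fun n => - (B + B) * harmonic n)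
      (fun n => (B + B) * harmonic n)); last 2 first.
  - by rewrite -[X in _ --> X](mulr0 (- (B + B))); apply: cvgMr; exact: cvg_harmonic.
  - by rewrite -[X in _ --> X](mulr0 (B + B)); apply: cvgMr; exact: cvg_harmonic.
  apply: nearW => n; rewrite mulNr -ler_norml normrM mulrC.
  rewrite ler_pM//; last by rewrite ger0_norm ?invr_ge0.
  apply: le_trans (ler_normB _ _) _; rewrite lerD//.
  exact: (mean_norm (expect_mean _)).
rewrite addr0 in c2.
have c3 : expect mu (fun x => cesaro n (fun y => f (x * y)%g)) @[n --> U] -->
    limit_mean f.
  by apply: cvg_trans c2; apply: near_eq_cvg; apply: nearW => n; rewrite expect_cesaro.
exact: (cvg_unique (@norm_hausdorff _ _) c1 c3).
Qed.

End stationary.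

Lemma ge_limn_einf (R : realType) (u : nat -> \bar R) (e : R) N :
  (forall n, (N <= n)%N -> (e%:E <= u n)%E) -> (e%:E <= limn_einf u)%E.
Proof.
move=> eu; rewrite limn_einf_lim (cvg_lim _ (@cvg_einfs_sup _ u))//.
apply: le_trans (ereal_sup_ubound (imageT _ N)).
by apply: le_ereal_inf_tmp => _ [n /= Nn <-]; exact: eu.
Qed.

Lemma finitely_additive_mean (R : realType) (G : groupType) (L : (G -> R) -> R) :
  mean_functional L -> finitely_additive (fun A => L \1_A).
Proof.
move=> mL; split=> [|A|A B AB].
- by rewrite -[RHS](mean1 mL); congr L; apply/funext => x; rewrite indicT.
- by apply: (mean_ge0 mL) => [|x]; [exact: bfun_indic|rewrite indicE ler0n].
rewrite -(meanD mL); [|exact: bfun_indic..].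
congr L; apply/funext => x; rewrite !indicE -natrD in_setU; congr _%:R.
have [xA|] := boolP (x \in A); have [xB|] := boolP (x \in B) => //.
by have : set0 x; [rewrite -AB; split; exact/set_mem|].
Qed.

(** The functions [g |-> L 1_(g^-1 A)], for a stationary mean [L], are bounded and
    harmonic. When the total variation distance comes close to zero at arbitrarily
    large times, all of them are invariant under the support of the law, which
    says that [L] itself is invariant under the subgroup generated by the support. *)
Lemma invariant_mean_of_tv (R : realType) (G : groupType) (S : seq G)
    (mu : probability (discr G) R) (rho : {i01 R}) :
  generating S -> rho%:num < 1 ->
  (forall e, 0 < e -> forall N, exists2 n, (N <= n)%N &
    (tv_dist (convolution_power (noisy_law mu rho) n)
      (product_law (convolution_power mu n) (convolution_power mu n)) <= e%:E)%E) ->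
  exists m : set G -> R, finitely_additive m /\
    left_invariant (subgroup_generated (law_support mu)) m.
Proof.
move=> genS rho1 tv0; have [U [UU sU]] := @ultraFilterLemma nat \oo _.
have mL := limit_mean_functional mu UU; pose L := limit_mean mu U.
exists (fun A => L \1_A); split; first exact: finitely_additive_mean.
pose K := [set g | forall A, L \1_[set x | A (g * x)%g] = L \1_A].
suff HK : subgroup_generated (law_support mu) `<=` K.
  by move=> h A /HK; exact.
suff sgK : is_subgroup K.
  move=> g; apply; split=> // x mux A.
  pose h g := L \1_[set y | A (g * y)%g].
  rewrite -[x]mul1g -[X in _ = L \1_X](_ : [set y | A (1 * y)%g] = A); last first.
    by apply/seteqP; split=> y /=; rewrite mul1g.
  apply: (@harmonic_support _ _ mu rho h) => // [y|k].
    have b := @bfun_indic R _ [set z | A (y * z)%g].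
    apply/andP; split.
      by apply: (mean_ge0 mL) => // z; rewrite indicE ler0n.
    rewrite -[leRHS](mean1 mL).
    apply: (mean_mono mL b (bfun_cst _ _)) => z.
    by rewrite indicE lern1 leq_b1.
  rewrite -[RHS](limit_mean_harmonic mu genS UU sU); last exact: bfun_indic.
  congr expect; apply/funext => x'; congr L; apply/funext => y.
  rewrite !indicE; congr (_ %:R); congr (nat_of_bool _).
  by apply/idP/idP; rewrite !inE /= mulgA.
apply: is_subgroupP => [A|g h gK hK A].
  by congr (L \1_ _); apply/seteqP; split=> y /=; rewrite mul1g.
rewrite -(gK A) -(hK [set x | A (g / h * x)%g]).
by congr (L \1_ _); apply/seteqP; split=> y /=; rewrite !mulgA mulgVK.
Qed.

(** * Failure of noise sensitivity *)

Theorem theorem1p2 (R : realType) (G : groupType)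
    (G_hyp : word_hyperbolic G R)
    (mu : probability (discr G) R) (mu_ne : non_elementary mu)
    (rho : {i01 R}) (rho_lt1 : (rho%:num < 1)%R) :
  (0 < limn_einf (fun n =>
     tv_dist (convolution_power (noisy_law mu rho) n)
             (product_law (convolution_power mu n) (convolution_power mu n))))%E.
Proof.
have [sgH not_vc] := mu_ne; have [S genS _] := G_hyp.
rewrite ltNge; apply/negP => liminf0; apply: not_vc.
have [|m [fam minv]] := @invariant_mean_of_tv _ _ S mu rho genS rho_lt1; last first.
  exact: invariant_mean_virtually_cyclic G_hyp sgH fam minv.
move=> e e0 N; apply: contrapT => far.
suff : (e%:E <= 0 :> \bar R)%E by rewrite lee_fin leNgt e0.
apply: le_trans liminf0; apply: (@ge_limn_einf _ _ _ N) => n Nn.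
by rewrite leNgt; apply/negP => /ltW tvn; apply: far; exists n.
Qed.
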